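(* For every fixed $t>-1/8$ and all integers $n\ge2$, \[ \ln\mathbb E\,e^{-t\hat L_n}=\frac{1-\sqrt{1+8t}}{4}\ln n+O(1), \] where the $O(1)$ term is bounded uniformly in $n$ (for fixed $t$).
   Context: $(B_t)_{t\ge0}$ is a standard Brownian motion and $\hat L_n=\int_1^nB_t^2/t^2\,dt$. *)

(* Defs.v *)
From HB Require Import structures.
From mathcomp Require Import all_boot all_order all_algebra.
From mathcomp Require Import all_classical all_reals all_analysis.
Set Implicit Arguments. Unset Strict Implicit. Unset Printing Implicit Defensive.
Import Order.TTheory GRing.Theory Num.Theory.
Import numFieldNormedType.Exports.
Local Open Scope classical_set_scope.
Local Open Scope ring_scope.

(* Mutual independence of the increments of a real process B over any finite
   increasing grid 0 <= ts 0 < ts 1 < ... < ts k: the events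
   {B (ts i.+1) - B (ts i) \in A i}, i < k, satisfy the product rule for all
   Borel sets A i (taking A i = setT gives the product rule for subfamilies). *)
Definition independent_increments {d : measure_display} {T : measurableType d}
  {R : realType} (P : probability T R) (B : R -> T -> R) : Prop :=
  forall (k : nat) (ts : nat -> R) (A : nat -> set R),
    0 <= ts 0%N ->
    (forall i : nat, (i < k)%N -> ts i < ts i.+1) ->
    (forall i : nat, (i < k)%N -> measurable (A i)) ->
    P (\bigcap_(i < k) [set w | B (ts i.+1) w - B (ts i) w \in A i])
    = (\prod_(i < k) P [set w | (B (ts i.+1) w - B (ts i) w)%R \in A i])%E.

(* Standard (one-dimensional) Brownian motion on the probability space
   (T, P), indexed by times t >= 0 (values at negative times are irrelevant). *)
Definition standard_brownian_motion {d : measure_display} {T : measurableType d}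
  {R : realType} (P : probability T R) (B : R -> T -> R) : Prop :=
  [/\ (forall t, 0 <= t -> measurable_fun setT (B t)),
      (forall w, B 0 w = 0),
      (forall w, {within `[0, +oo[, continuous (fun t => B t w)}),
      (forall s t, 0 <= s -> s < t -> forall A : set R, measurable A ->
          P [set w | B t w - B s w \in A] = normal_prob 0 (Num.sqrt (t - s)) A)
    & independent_increments P B].

Definition Lhat {R : realType} {T : Type} (B : R -> T -> R) (n : nat) (w : T) : R :=
  Rintegral lebesgue_measure `[1%R, n%:R] (fun s => B s w ^+ 2 / s ^+ 2).

Definition laplace_Lhat {d : measure_display} {T : measurableType d}
  {R : realType} (P : probability T R) (B : R -> T -> R) (t : R) (n : nat) : \bar R :=
  (\int[P]_w (expR (- t * Lhat B n w))%:E)%E.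

(* Main.v *)
Require Import Defs.
From HB Require Import structures.
From mathcomp Require Import all_boot all_order all_algebra.
From mathcomp Require Import all_classical all_reals all_analysis.
From mathcomp Require Import measurable_realfun ring lra.
Import Order.TTheory GRing.Theory Num.Theory.
Import numFieldNormedType.Exports.
Local Open Scope classical_set_scope.
Local Open Scope ring_scope.

(** Put [c := (sqrt (1 + 8 t) - 1) / 2], so that [c (1 + c) = 2 t] and
    [c > - 1 / 2]. On the geometric grid [q ^ i], with [q ^ N = n], the
    integral becomes a weighted sum of the squares of the stationary AR(1) chain
    [X_i = B (q ^ i) / q ^ (i / 2)]. Integrating out one Gaussian increment
    maps the terminal factor [exp (- b X_i ^ 2 / 2)] to a multiple of
    [exp (- b' X_(i - 1) ^ 2 / 2)], where [b'] is a Moebius function of [b]. For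
    a suitable weight, tending to [2 t log q], this Moebius map fixes [c], and
    the inverse square of the Laplace transform evolves by a linear operator
    with an explicit positive eigenfunction [1 + r b] and eigenvalue
    [1 + c (1 - 1 / q)]. Comparing the initial value [1 + b] with the
    eigenfunction bounds the discrete Laplace transform between constant
    multiples of [(1 + c (1 - 1 / q)) ^ (- N / 2)], which tends to
    [n ^ (- c / 2)].
    The upper bound passes to the limit [N -> oo] by Fatou's lemma, the lower
    bound by dominated convergence after truncation; for [t < 0] the truncation
    error is controlled by the same bound at a slightly smaller exponent. *)

(** * Integrating out an independent variable *)

Section independence.
Context {d d' : measure_display} {T : measurableType d} {U : measurableType d'}
  {R : realType}.
Variables (P : probability T R) (G : set_system T) (D : T -> U).
Hypotheses (mD : measurable_fun setT D) (mG : G `<=` measurable)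
  (GI : setI_closed G) (GT : G setT).
Hypothesis GD : forall E A, G E -> measurable A ->
  P (E `&` D @^-1` A) = (P E * P (D @^-1` A))%E.

(** For fixed [A], both sides are finite measures in [E]: a restriction of [P] and a multiple of
    [P]. They agree on the pi-system [G], hence on what it generates. *)
Lemma independent_generated (E : set T) (A : set U) :
  <<s G >> E -> measurable A ->
  P (E `&` D @^-1` A) = (P E * P (D @^-1` A))%E.
Proof.
move=> GE mA.
have mDA : measurable (D @^-1` A) by rewrite -(setTI (_ @^-1` _)); exact: mD.
have p0 : 0 <= fine (P (D @^-1` A)) by rewrite fine_ge0.
have -> : P (E `&` D @^-1` A) = mrestr P mDA E by [].
have -> : (P E * P (D @^-1` A))%E = mscale (NngNum p0) P E.
  by rewrite /mscale/= muleC fineK ?fin_num_measure.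
apply: (g_sigma_algebra_measure_unique G mG (fun=> setT)) => //.
- by rewrite bigcup_const.
- move=> F GF; rewrite /= /mrestr /mscale/= GD// muleC fineK ?fin_num_measure//.
- move=> _; rewrite /= /mrestr setTI.
  by apply: le_lt_trans (probability_le1 _ mDA) _; exact: ltry.
Qed.

Variable nu : probability U R.
Hypothesis Dnu : forall A, measurable A -> P (D @^-1` A) = nu A.

(* The law of [(w, D w)] on [<<s G >> x U] is the product of [P] and [nu]. *)
Lemma integral_independent (f : g_sigma_algebraType G * U -> \bar R) :
  measurable_fun setT f -> (forall x, 0 <= f x)%E ->
  (\int[P]_w f (w, D w) = \int[P]_w \int[nu]_z f (w, z))%E.
Proof.
move=> mf f0.
(* The identity to the coarser sigma-algebra lets [w] serve as a coordinate that is independent of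
   [D w]. *)
have mid : measurable_fun setT (id : T -> g_sigma_algebraType G).
  move=> _ Y sY; rewrite setTI preimage_id.
  exact: (@smallest_sub _ _ _ _ (sigma_algebra_measurable T) mG).
pose I : {mfun T >-> g_sigma_algebraType G} :=
  HB.pack (id : T -> g_sigma_algebraType G) (isMeasurableFun.Build _ _ _ _ _ mid).
pose phi w : g_sigma_algebraType G * U := (I w, D w).
have mphi : measurable_fun setT phi.
  by apply/measurable_fun_pairP; split => //; exact: measurable_funP.
pose Phi : {mfun T >-> (g_sigma_algebraType G * U)%type} :=
  HB.pack phi (isMeasurableFun.Build _ _ _ _ _ mphi).
transitivity (\int[pushforward P Phi]_x f x)%E.
  by rewrite ge0_integral_pushforward.
transitivity (\int[distribution P I \x nu]_x f x)%E.
  apply: eq_measure_integral => X mX _.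
  apply/esym; apply: product_measure_unique => //.
  move=> A B mA mB; rewrite /pushforward /distribution /pushforward /=.
  rewrite -Dnu//; exact: independent_generated.
rewrite fubini_tonelli1//=.
rewrite ge0_integral_pushforward//=.
- exact: measurable_fun_fubini_tonelli_F.
- by move=> x _; exact: integral_ge0.
Qed.
End independence.

(** * Gaussian integrals *)

Section density.
Context {d : measure_display} {T : measurableType d} {R : realType}.
Variables (mu nu : {measure set T -> \bar R}) (p : T -> R).
Hypotheses (mp : measurable_fun setT p) (p0 : forall x, 0 <= p x).
Hypothesis nuE : forall A, measurable A -> nu A = (\int[mu]_(x in A) (p x)%:E)%E.
Import HBNNSimple.

(** Monotone convergence reduces to simple functions and linearity to indicators, where [nuE]
    applies. *)
Lemma integral_density (f : T -> \bar R) :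
  measurable_fun setT f -> (forall x, 0 <= f x)%E ->
  (\int[nu]_x f x = \int[mu]_x (f x * (p x)%:E))%E.
Proof.
move=> mf f0.
pose g := nnsfun_approx measurableT mf.
have gf x : EFin \o g ^~ x @ \oo --> f x by exact: cvg_nnsfun_approx.
transitivity (limn (fun n => \int[nu]_x (g n x)%:E))%E.
  rewrite -monotone_convergence//=.
  - by apply: eq_integral => x _; apply/esym/cvg_lim => //; exact: gf.
  - by move=> n; exact/measurable_EFinP.
  - by move=> n x _; rewrite lee_fin.
  - by move=> x _ m n mn; rewrite lee_fin; exact/lefP/nd_nnsfun_approx.
transitivity (limn (fun n => \int[mu]_x ((g n x)%:E * (p x)%:E)))%E; last first.
  rewrite -monotone_convergence//=.
  - apply: eq_integral => x _; apply/cvg_lim => //.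
    by apply: cvgeZr => //; exact: gf.
  - by move=> n; apply/measurable_EFinP; exact: measurable_funM.
  - by move=> n x _; rewrite -EFinM lee_fin mulr_ge0.
  - move=> x _ m n mn; rewrite lee_wpmul2r ?lee_fin//.
    exact/lefP/nd_nnsfun_approx.
congr (limn _); apply/funext => n.
under eq_integral do rewrite fimfunE -fsumEFin//.
rewrite ge0_integral_fsum//; last 2 first.
  - by move=> r; exact/measurable_EFinP/measurableT_comp.
  - by move=> r x _; rewrite EFinM nnfun_muleindic_ge0.
under [RHS]eq_integral.
  move=> x _; rewrite fimfunE -fsumEFin// ge0_mule_fsuml; last first.
    by move=> r; rewrite EFinM nnfun_muleindic_ge0.
  over.
rewrite [RHS]ge0_integral_fsum//; last 2 first.
  - move=> r; apply/measurable_EFinP/measurable_funM => //.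
    exact/measurableT_comp.
  - move=> r x _; apply: mule_ge0; last by rewrite lee_fin.
    by rewrite EFinM nnfun_muleindic_ge0.
apply: eq_fsbigr => r _.
rewrite integralZl_indic_nnsfun// integral_indic// setIT nuE//.
under [RHS]eq_integral do rewrite EFinM -muleA.
have [r0|r0] := leP 0 r.
  rewrite ge0_integralZl//; last 2 first.
    - by apply/measurable_EFinP/measurable_funM.
    - by move=> x _; rewrite -EFinM lee_fin mulr_ge0.
  congr *%E; rewrite integral_mkcond; apply: eq_integral => x _.
  by rewrite patchE indicE; case: ifPn => _; rewrite ?mul1e ?mul0e.
have -> : g n @^-1` [set r] = set0.
  by rewrite preimage_nnfun0.
rewrite integral_set0 mule0; under eq_integral do rewrite indic0 mul0e mule0.
by rewrite integral0.
Qed.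
End density.

(** Tilting the centred normal density of variance [v] by [exp (- a (x + z) ^ 2 / 2)] gives a normal
    density of variance [v / (1 + a * v)] with shifted mean, up to a factor free of [z]. *)
Lemma complete_square {R : realFieldType} (a v x z : R) :
  0 < v -> 0 < 1 + a * v ->
  - (a * (x + z) ^+ 2 / 2) + - (z - 0) ^+ 2 / (v *+ 2) =
  - (a / (1 + a * v) * x ^+ 2 / 2) +
  - (z - - (a * v * x / (1 + a * v))) ^+ 2 / (v / (1 + a * v) *+ 2).
Proof.
move=> /lt0r_neq0 v0 /lt0r_neq0 w0; rewrite -(mulr_natr v) -(mulr_natr (v / _)) subr0.
by field; rewrite v0 w0.
Qed.

Lemma integral_normal_expR_sqr {R : realType} (a v x : R) :
  0 < v -> 0 < 1 + a * v ->
  (\int[normal_prob 0 (Num.sqrt v)]_z (expR (- (a * (x + z) ^+ 2 / 2)))%:E =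
   ((Num.sqrt (1 + a * v))^-1 * expR (- (a / (1 + a * v) * x ^+ 2 / 2)))%:E)%E.
Proof.
move=> v0 w0; set w := 1 + a * v; rewrite -/w in w0.
have sv : Num.sqrt v != 0 by rewrite gt_eqF ?sqrtr_gt0.
have svw : Num.sqrt (v / w) != 0 by rewrite gt_eqF// sqrtr_gt0 divr_gt0.
rewrite (integral_density lebesgue_measure _ (normal_pdf 0 (Num.sqrt v)))//=; first last.
- apply/measurable_EFinP; apply: measurableT_comp => //.
  apply: measurableT_comp => //; apply: measurable_funM => //.
  apply: measurable_funM => //; apply: measurable_funX => //.
  exact: measurable_funD.
- by move=> z; exact: normal_pdf_ge0.
- exact: measurable_normal_pdf.
pose C := (Num.sqrt w)^-1 * expR (- (a / w * x ^+ 2 / 2)).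
transitivity (\int[lebesgue_measure]_z
  (C%:E * (normal_pdf (- (a * v * x / w)) (Num.sqrt (v / w)) z)%:E))%E.
  apply: eq_integral => z _; rewrite -!EFinM; congr EFin.
  rewrite !normal_pdfE//= /normal_peak /normal_fun !sqr_sqrtr ?ltW ?divr_gt0//.
  have -> : v * pi *+ 2 = w * (v / w * pi *+ 2).
    rewrite -mulrnAr -[in RHS]mulrnAr; field; exact: lt0r_neq0.
  rewrite sqrtrM ?ltW// invfM /C.
  rewrite mulrCA [RHS]mulrACA; congr (_ * _).
  by rewrite -!expRD complete_square.
rewrite integralZl//=; last exact: integrable_normal_pdf.
by rewrite integral_normal_pdf mule1.
Qed.

(** * Quadratic functionals of Brownian motion along a grid *)

Section quadratic_functional.
Context {d : measure_display} {T : measurableType d} {R : realType}.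
Variables (P : probability T R) (B : R -> T -> R).
Hypothesis BM : standard_brownian_motion P B.
Variable tau : nat -> R.
Hypotheses (tau0 : tau 0 = 0) (tau_lt : forall i, tau i < tau i.+1).

Let mB t : 0 <= t -> measurable_fun setT (B t).
Proof. by case: BM => + _ _ _ _; exact. Qed.

Lemma grid_ge0 i : 0 <= tau i.
Proof. by elim: i => [|i /le_trans->//]; rewrite ?tau0// ltW. Qed.

Definition increment i w := B (tau i.+1) w - B (tau i) w.

Lemma measurable_increment i : measurable_fun setT (increment i).
Proof. by apply: measurable_funB; apply: mB; exact: grid_ge0. Qed.

(** A pi-system generating the sigma-algebra of the first [k] increments, made of the events of
    [independent_increments]. *)
Definition past k : set_system T :=
  [set E | exists2 A : nat -> set R, (forall i, measurable (A i)) &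
    E = \bigcap_(i < k) increment i @^-1` A i].

Lemma past_measurable k : past k `<=` measurable.
Proof.
move=> _ [A mA ->]; rewrite bigcap_mkord; apply: bigsetI_measurable => i _.
by rewrite -(setTI (_ @^-1` _)); exact: measurable_increment.
Qed.

Lemma past_setI k : setI_closed (past k).
Proof.
move=> _ _ [A mA ->] [A' mA' ->]; exists (fun i => A i `&` A' i).
  by move=> i; exact: measurableI.
by rewrite -bigcapI; apply: eq_bigcapr => i _; rewrite preimage_setI.
Qed.

Lemma past_setT k : past k setT.
Proof.
by exists (fun=> setT) => //; apply/esym; rewrite -subTset => w _ i _.
Qed.

(** The product rule is applied twice to one family, [F] continued by [A]: over [k + 1] increments
    and over the first [k]. *)
Lemma increment_independent_past k E A : past k E -> measurable A ->
  P (E `&` increment k @^-1` A) = (P E * P (increment k @^-1` A))%E.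
Proof.
move=> [F mF ->] mA; case: BM => _ _ _ _ ind.
have pre i C : increment i @^-1` C = [set w | increment i w \in C].
  by apply/seteqP; split => w /=; rewrite in_setE.
pose F' i := if (i < k)%N then F i else A.
have mF' i : measurable (F' i) by rewrite /F'; case: ifP.
have t0 : 0 <= tau 0 by rewrite tau0.
have EF : \bigcap_(i < k) increment i @^-1` F i =
    \bigcap_(i < k) [set w | increment i w \in F' i].
  by apply: eq_bigcapr => i /= ik; rewrite pre /F' ik.
have := ind k.+1 tau F' t0 (fun i _ => tau_lt i) (fun i _ => mF' i).
rewrite big_ord_recr/= -(ind k tau F' t0 (fun i _ => tau_lt i) (fun i _ => mF' i)).
have FA : F' k = A by rewrite /F' ltnn.
by rewrite IIS bigcap_setU bigcap_set1 FA EF pre.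
Qed.

(** As [B] vanishes at [tau 0 = 0], [B (tau j)] is the sum of the first [j] increments. *)
Lemma measurable_past k j : (j <= k)%N ->
  measurable_fun setT (B (tau j) : g_sigma_algebraType (past k) -> R).
Proof.
elim: j => [_|j IH jk].
  rewrite tau0; case: BM => _ B0 _ _ _.
  by rewrite (_ : B 0 = cst 0) //; apply/funext => w; exact: B0.
rewrite (_ : B (tau j.+1) = B (tau j) \+ increment j); last first.
  by apply/funext => w; rewrite /= /increment addrC subrK.
apply: measurable_funD; first by apply: IH; exact: ltnW.
move=> _ Y mY; rewrite setTI; apply: sub_sigma_algebra.
exists (fun i => if i == j then Y else setT); first by move=> i; case: ifP.
apply/seteqP; split => [w Yw i _ /=|w /(_ j jk) /=]; last by rewrite eqxx.
by case: ifPn => // /eqP ->.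
Qed.

(** The terminal coefficient [a] is kept apart from the weights because it alone changes in the
    recursion on [k]. *)
Definition quad_exp k (th : nat -> R) a w :=
  expR (- ((\sum_(j < k) th j * B (tau j) w ^+ 2 + a * B (tau k) w ^+ 2) / 2)).

Definition quad_laplace k th a : \bar R := (\int[P]_w (quad_exp k th a w)%:E)%E.

Lemma quad_laplace0 th a : quad_laplace 0 th a = 1%E.
Proof.
case: BM => _ B0 _ _ _.
rewrite /quad_laplace; under eq_integral.
  move=> w _; rewrite /quad_exp big_ord0 tau0 B0 expr0n/= mulr0 addr0 mul0r.
  rewrite oppr0 expR0; over.
rewrite integral_cst//= mul1e; exact: probability_setT.
Qed.

(** The last increment is independent of the past and normal of variance [v]. Integrating it out
    leaves [a / (1 + a * v)] on [B (tau k) ^ 2], which joins the weight [th k] as the new terminal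
    coefficient. *)
Lemma quad_laplaceS k th a : let v := tau k.+1 - tau k in
  0 < 1 + a * v ->
  quad_laplace k.+1 th a =
  ((Num.sqrt (1 + a * v))^-1%:E * quad_laplace k th (th k + a / (1 + a * v)))%E.
Proof.
move=> v w0; have v0 : 0 < v by rewrite subr_gt0.
pose f (x : g_sigma_algebraType (past k) * R) : \bar R :=
  (expR (- ((\sum_(j < k.+1) th j * B (tau j) x.1 ^+ 2) / 2)) *
   expR (- (a * (B (tau k) x.1 + x.2) ^+ 2 / 2)))%:E.
have mB1 j : (j <= k)%N -> measurable_fun setT
    (fun x : g_sigma_algebraType (past k) * R => B (tau j) x.1).
  by move=> jk; apply: measurableT_comp; [exact: measurable_past|].
have mf : measurable_fun setT f.
  apply/measurable_EFinP; apply: measurable_funM.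
  - apply: measurableT_comp => //; apply: measurableT_comp => //.
    apply: measurable_funM => //; apply: measurable_sum => j.
    apply: measurable_funM => //; apply: measurable_funX.
    by apply: mB1; rewrite -ltnS.
  - apply: measurableT_comp => //; apply: measurableT_comp => //.
    apply: measurable_funM => //; apply: measurable_funM => //.
    apply: measurable_funX; apply: measurable_funD => //.
    exact: mB1.
have law A : measurable A ->
    P (increment k @^-1` A) = normal_prob 0 (Num.sqrt v) A.
  move=> mA; case: BM => _ _ _ /(_ _ _ (grid_ge0 k) (tau_lt k) A mA) <- _.
  by congr (P _); apply/seteqP; split => z /=; rewrite in_setE.
have f0 x : (0 <= f x)%E by rewrite lee_fin mulr_ge0// expR_ge0.
pose nu : probability (measurableTypeR R) R := normal_prob 0 (Num.sqrt v).
have key : (\int[P]_w f (w, increment k w) =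
    \int[P]_w \int[nu]_z f (w, z))%E.
  exact: (@integral_independent _ _ _ _ _ P (past k)
    (increment k : T -> measurableTypeR R) (measurable_increment k)
    (@past_measurable k) (@past_setI k) (past_setT k)
    (@increment_independent_past k) nu law f mf f0).
transitivity (\int[P]_w f (w, increment k w))%E.
  apply: eq_integral => w _; rewrite /f /quad_exp/= -expRD.
  congr (expR _)%:E; rewrite /increment [B (tau k) w + _]addrC subrK.
  by rewrite -opprD -mulrDl.
rewrite key -ge0_integralZl//=.
- apply: eq_integral => w _.
  rewrite /f; under eq_integral do rewrite EFinM.
  rewrite /= ge0_integralZl//=; last first.
    apply/measurable_EFinP.
    apply: measurableT_comp => //; apply: measurableT_comp => //.
    apply: measurable_funM => //; apply: measurable_funM => //.
    by apply: measurable_funX; apply: measurable_funD.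
  rewrite integral_normal_expR_sqr// -EFinM; congr EFin.
  rewrite mulrCA -expRD; congr (_ * expR _).
  rewrite big_ord_recr/= -opprD -mulrDl; congr (- (_ / 2)).
  by rewrite mulrDl addrA.
- apply/measurable_EFinP; apply: measurableT_comp => //.
  apply: measurableT_comp => //; apply: measurable_funM => //.
  apply: measurable_funD.
    apply: measurable_sum => j; apply: measurable_funM => //.
    by apply: measurable_funX; apply: mB; exact: grid_ge0.
  by apply: measurable_funM => //; apply: measurable_funX; apply: mB; exact: grid_ge0.
- by move=> w _; rewrite lee_fin expR_ge0.
Qed.

End quadratic_functional.

(** * Geometric grids *)

Section riccati.
Context {R : realFieldType}.
Variables c h : R.
Hypotheses (c_gt : - (1 / 2) < c) (h_gt0 : 0 < h) (h_lt1 : h < 1).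

(* The weight for which [c] is a fixed point of [riccati_map]. *)
Definition riccati_weight := c * (1 + c) * h / (1 + c * h).
(** One step of [quad_laplaceS] on the grid of ratio [q = 1 / (1 - h)], for the scaled coefficient
    [b = a * q ^ k]. *)
Definition riccati_map b := riccati_weight + b * (1 - h) / (1 + b * h).
(** [- 1 / riccati_slope] is the second fixed point of [riccati_map], and the zero of the
    eigenfunction. *)
Definition riccati_slope := (1 + c * h) / (1 + c).
(* The two summands serve the cases [0 <= c] and [c < 0] respectively. *)
Definition riccati_const := (1 + c) + (1 + c) ^+ 2 / (1 + 2 * c).
(** A set that contains the starting value 0, is invariant under [riccati_map], and keeps the
    denominators and the eigenfunction positive. *)
Definition riccati_dom b := 0 <= c /\ 0 <= b \/ c <= b <= 0.

Lemma riccati_denom_gt0 b : riccati_dom b -> 0 < 1 + b * h.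
Proof. by move: c_gt h_gt0 h_lt1 => ? ? ? [[? ?]|/andP[? ?]]; nra. Qed.

Lemma riccati_eigen_gt0 : 0 < 1 + c * h.
Proof. by move: c_gt h_gt0 h_lt1 => ? ? ?; nra. Qed.

Let c1_gt0 : 0 < 1 + c. Proof. by move: c_gt => ?; lra. Qed.

Lemma riccati_fun_gt0 b : riccati_dom b -> 0 < 1 + riccati_slope * b.
Proof.
move=> bD; rewrite /riccati_slope.
have -> : 1 + (1 + c * h) / (1 + c) * b = (1 + c + (1 + c * h) * b) / (1 + c).
  by field; exact: lt0r_neq0.
rewrite divr_gt0//; move: c_gt h_gt0 h_lt1 => ? ? ?.
case: bD => [[c0 b0]|/andP[cb b0]].
  by rewrite ltr_wpDr// mulr_ge0// ltW// riccati_eigen_gt0.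
(* The numerator is at least its value at [b = c], which is [1 + 2 * c + c ^ 2 * h], positive
   because [c > - 1 / 2]. *)
have : 0 <= (b - c) * (1 + c * h) by rewrite mulr_ge0 ?subr_ge0// ltW// riccati_eigen_gt0.
have : 0 <= c ^+ 2 * h by rewrite mulr_ge0 ?sqr_ge0// ltW.
nra.
Qed.

Lemma riccati_map_dom b : riccati_dom b -> riccati_dom (riccati_map b).
Proof.
move=> bD; have b1 := riccati_denom_gt0 _ bD; have c1 := riccati_eigen_gt0.
have h1 : 0 < 1 - h by rewrite subr_gt0.
case: bD => [[c0 b0]|/andP[cb b0]].
  left; split => //; rewrite /riccati_map /riccati_weight addr_ge0//.
    by apply: divr_ge0; [rewrite !mulr_ge0// ltW|exact: ltW].
  by apply: divr_ge0; [rewrite mulr_ge0// ltW|exact: ltW].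
have c0 := le_trans cb b0.
right; apply/andP; split; rewrite /riccati_map /riccati_weight.
  (* Since [c] is a fixed point, [riccati_map b - c] has the factor [b - c]. *)
  rewrite -subr_ge0.
  have -> : c * (1 + c) * h / (1 + c * h) + b * (1 - h) / (1 + b * h) - c =
      (1 - h) * (b - c) / ((1 + b * h) * (1 + c * h)).
    by field; rewrite !lt0r_neq0.
  by rewrite divr_ge0 ?mulr_ge0 ?subr_ge0// ltW.
rewrite -oppr_ge0 opprD addr_ge0// -!mulNr; apply: divr_ge0; rewrite ?(ltW b1) ?(ltW c1)//.
  by rewrite !mulr_ge0 ?oppr_ge0// ltW.
by rewrite mulr_ge0 ?oppr_ge0// ltW.
Qed.

(* The operator [g |-> (1 + b * h) * g (riccati_map b)] drives the inverse square
   of the Laplace transform. *)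
Lemma riccati_eigen b : riccati_dom b ->
  (1 + b * h) * (1 + riccati_slope * riccati_map b) =
  (1 + c * h) * (1 + riccati_slope * b).
Proof.
move=> bD; have b1 := riccati_denom_gt0 _ bD; have c1 := riccati_eigen_gt0.
rewrite /riccati_slope /riccati_map /riccati_weight.
by field; rewrite !lt0r_neq0.
Qed.

Lemma riccati_const_gt0 : 0 < riccati_const.
Proof.
by rewrite addr_gt0// divr_gt0 ?exprn_gt0//; move: c_gt => ?; lra.
Qed.

Lemma riccati_fun_le b : riccati_dom b -> 1 + riccati_slope * b <= 1 + b.
Proof.
move=> bD; rewrite lerD2l -subr_ge0 /riccati_slope.
have -> : b - (1 + c * h) / (1 + c) * b = (c * b) * (1 - h) / (1 + c).
  by field; exact: lt0r_neq0.
apply: divr_ge0; last exact: ltW.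
apply: mulr_ge0; last by rewrite subr_ge0 ltW.
by case: bD => [[? ?]|/andP[? ?]]; nra.
Qed.

Lemma riccati_fun_ge b : riccati_dom b ->
  1 + b <= riccati_const * (1 + riccati_slope * b).
Proof.
move=> bD; have g0 := riccati_fun_gt0 _ bD.
have c2 : 0 < 1 + 2 * c by move: c_gt => ?; lra.
rewrite mulrDl; move: g0; rewrite /riccati_slope => g0.
have [c0|c0] := leP 0 c.
  apply: ler_wpDr; first by rewrite mulr_ge0 ?(ltW g0)// divr_ge0 ?sqr_ge0// ltW.
  have -> : (1 + c) * (1 + (1 + c * h) / (1 + c) * b) = 1 + c + (1 + c * h) * b.
    by field; exact: lt0r_neq0.
  have b0 : 0 <= b by case: bD => [[]//|/andP[]]; move/(le_trans c0).
  have : 0 <= c * h * b by rewrite !mulr_ge0// ltW.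
  by move: c0; lra.
have /andP[cb b0] : c <= b <= 0.
  by case: bD => [[]|//]; rewrite leNgt c0.
apply: ler_wpDl; first by rewrite mulr_ge0 ?ltW.
rewrite mulrAC ler_pdivlMr//.
have -> : (1 + c) ^+ 2 * (1 + (1 + c * h) / (1 + c) * b) =
   (1 + c) * (1 + c + (1 + c * h) * b).
  by field; exact: lt0r_neq0.
have hb : 0 <= c * b * h by rewrite mulr_ge0 ?(ltW h_gt0)// mulr_le0// ltW.
apply: (@le_trans _ _ ((1 + c) * (1 + c + b))); last first.
  by rewrite ler_pM2l// lerD2l mulrDl mul1r mulrAC lerDl.
rewrite -subr_ge0.
have -> : (1 + c) * (1 + c + b) - (1 + b) * (1 + 2 * c) = (- c) * (b - c).
  by ring.
by rewrite mulr_ge0 ?oppr_ge0 ?subr_ge0// ltW.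
Qed.
End riccati.

Section geometric_grid.
Context {d : measure_display} {T : measurableType d} {R : realType}.
Variables (P : probability T R) (B : R -> T -> R).
Hypothesis BM : standard_brownian_motion P B.
Variables c q : R.
Hypotheses (c_gt : - (1 / 2) < c) (q_gt1 : 1 < q).
Let h := 1 - q^-1.
Let kap := riccati_weight c h.

Let q_gt0 : 0 < q. Proof. exact: lt_trans q_gt1. Qed.
Let h_gt0 : 0 < h. Proof. by rewrite subr_gt0 invf_lt1. Qed.
Let h_lt1 : h < 1. Proof. by rewrite ltrBlDr ltrDl invr_gt0. Qed.

(** Time 0 precedes the powers of [q] because the recursion must end at [B 0 = 0]. *)
Definition geometric_grid k := if k is i.+1 then q ^+ i else 0.

Lemma geometric_grid_lt i : geometric_grid i < geometric_grid i.+1.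
Proof. by case: i => [|i]/=; rewrite ?expr0// ltr_eXn2l. Qed.

(* At [j = 0] the weight is junk, but there [B] vanishes. *)
Let th j := kap / geometric_grid j.
(** The terminal time is [q ^ k], so [b] multiplies the normalised square
    [B (q ^ k) ^ 2 / q ^ k]. *)
Let F k b := quad_laplace P B geometric_grid k.+1 th (b / q ^+ k).

Lemma geometric_laplace0 b : 0 < 1 + b -> F 0 b = ((Num.sqrt (1 + b))^-1)%:E.
Proof.
move=> b1.
rewrite /F (quad_laplaceS _ _ BM _ erefl geometric_grid_lt)/= expr0 divr1 subr0 mulr1//.
by rewrite quad_laplace0// mule1.
Qed.

Lemma geometric_laplaceS k b : riccati_dom c b ->
  F k.+1 b = ((Num.sqrt (1 + b * h))^-1%:E * F k (riccati_map c h b))%E.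
Proof.
move=> bD; have b1 := riccati_denom_gt0 _ _ c_gt h_gt0 h_lt1 _ bD.
have qk : 0 < q ^+ k by rewrite exprn_gt0.
have E : b / q ^+ k.+1 * (q ^+ k.+1 - q ^+ k) = b * h.
  by rewrite /h exprS; field; rewrite !lt0r_neq0.
rewrite /F (quad_laplaceS _ _ BM _ erefl geometric_grid_lt)/= E//; congr (_ * quad_laplace _ _ _ _ _ _)%E.
rewrite /th/= /riccati_map -/kap mulrDl; congr (_ + _).
have -> : 1 - h = q^-1 by rewrite /h opprB addrC subrK.
rewrite exprS; field.
by rewrite !lt0r_neq0.
Qed.

(** Induction on [k]: [riccati_eigen] carries both bounds through a step, and the comparison of
    [1 + b] with the eigenfunction starts it. *)
Lemma geometric_laplace_bounds k b : riccati_dom c b ->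
  (((Num.sqrt (riccati_const c * (1 + c * h) ^+ k *
      (1 + riccati_slope c h * b)))^-1)%:E <= F k b <=
   ((Num.sqrt ((1 + c * h) ^+ k * (1 + riccati_slope c h * b)))^-1)%:E)%E.
Proof.
have c1 := riccati_eigen_gt0 _ _ c_gt h_gt0 h_lt1.
have K0 := riccati_const_gt0 _ c_gt.
elim: k b => [|k IH] b bD.
  have g0 := riccati_fun_gt0 _ _ c_gt h_gt0 h_lt1 _ bD.
  have gle := riccati_fun_le _ _ c_gt h_lt1 _ bD.
  have gge := riccati_fun_ge _ _ c_gt h_gt0 h_lt1 _ bD.
  have b1 : 0 < 1 + b by exact: lt_le_trans gle.
  rewrite geometric_laplace0// !lee_fin expr0 mulr1 mul1r.
  rewrite !lef_pV2 ?posrE ?sqrtr_gt0 ?mulr_gt0//.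
  by rewrite !ler_wsqrtr.
have b1 := riccati_denom_gt0 _ _ c_gt h_gt0 h_lt1 _ bD.
have g0 := riccati_fun_gt0 _ _ c_gt h_gt0 h_lt1 _ (riccati_map_dom _ _ c_gt h_gt0 h_lt1 _ bD).
have e := riccati_eigen _ _ c_gt h_gt0 h_lt1 _ bD.
(* Used with [X = riccati_const c] for the lower bound and [X = 1] for the upper one. *)
have step X : 0 < X ->
    (Num.sqrt (X * (1 + c * h) ^+ k.+1 * (1 + riccati_slope c h * b)))^-1 =
    (Num.sqrt (1 + b * h))^-1 *
    (Num.sqrt (X * (1 + c * h) ^+ k * (1 + riccati_slope c h * riccati_map c h b)))^-1.
  move=> X0; rewrite -invfM -sqrtrM ?ltW//; congr (Num.sqrt _)^-1.
  by rewrite [RHS]mulrCA e exprS; ring.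
have /andP[lo up] := IH _ (riccati_map_dom _ _ c_gt h_gt0 h_lt1 _ bD).
rewrite geometric_laplaceS// step// -(mul1r ((1 + c * h) ^+ k.+1)) step// mul1r.
rewrite !EFinM; apply/andP; split.
  by rewrite lee_wpmul2l// lee_fin invr_ge0 sqrtr_ge0.
by rewrite lee_wpmul2l// lee_fin invr_ge0 sqrtr_ge0.
Qed.

Definition geometric_sum N w := \sum_(i < N) B (q ^+ i) w ^+ 2 / q ^+ i.

Lemma laplace_geometric_sum N :
  (((Num.sqrt (riccati_const c * (1 + c * h) ^+ N))^-1)%:E <=
   \int[P]_w (expR (- (kap / 2 * geometric_sum N w)))%:E <=
   ((Num.sqrt ((1 + c * h) ^+ N))^-1)%:E)%E.
Proof.
have D0 : riccati_dom c 0.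
  by rewrite /riccati_dom lexx; have [?|/ltW ?] := leP 0 c; [left|right; apply/andP].
have := geometric_laplace_bounds N 0 D0; rewrite mulr0 addr0 !mulr1.
suff -> : F N 0 = (\int[P]_w (expR (- (kap / 2 * geometric_sum N w)))%:E)%E by [].
rewrite /F /quad_laplace; apply: eq_integral => w _.
case: BM => _ B0 _ _ _.
rewrite /quad_exp mul0r mul0r addr0 big_ord_recl /geometric_grid B0 expr0n/= mulr0 add0r.
congr (expR (- _))%:E; rewrite /geometric_sum mulrAC; congr (_ / 2).
rewrite mulr_sumr; apply: eq_bigr => i _; rewrite /th /= add0n.
by rewrite mulrAC [RHS]mulrA.
Qed.
End geometric_grid.

(** * Riemann sums *)

(** Heine-Cantor: half the radius of continuity at a point leaves room for a second nearby point,
    and compactness makes the choice uniform. *)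
Lemma continuous_compact_uniform {R : realType} (K : set R) (f : R -> R) (e : R) :
  compact K -> {within K, continuous f} -> 0 < e ->
  \forall r \near (0 : R)^'+, forall x y, K x -> K y -> `|x - y| <= r ->
    `|f x - f y| <= e.
Proof.
move=> cK cf e0.
have /compact_near_coveringP/near_covering_withinP cov := cK.
suff : \forall r \near (0 : R)^'+, K `<=`
    [set x | forall y, K y -> `|x - y| <= r -> `|f x - f y| <= e].
  by apply: filterS => r Kr x y Kx; exact: Kr.
apply: cov => x Kx.
have /subspace_continuousP/(_ x Kx)/cvgrPdist_lt/(_ (e / 2)) := cf.
rewrite divr_gt0// => /(_ isT); rewrite near_withinE.
move=> /nbhs_ballP[r /= r0 xr].
have r20 : 0 < r / 2 by rewrite divr_gt0.
exists (ball x (r / 2), [set s | s < r / 2]).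
  by split => /=; [exact: nbhsx_ballx|exact: nbhs_right_lt].
move=> [y s] /= [xy sr] Ky z Kz yz.
have h1 : `|f x - f y| < e / 2.
  by apply: xr => //; apply: le_ball xy; move: r0; lra.
have h2 : `|f x - f z| < e / 2.
  apply: xr => //; rewrite /ball/= (splitr r).
  rewrite (le_lt_trans (ler_distD y _ _))// ltrD//.
  exact: le_lt_trans sr.
rewrite (le_trans (ler_distD (f x) _ _))// (splitr e) lerD// ?ltW//.
by rewrite distrC.
Qed.

Lemma riemann_sum_dist {R : realType} (f : R -> R) (s : nat -> R) (e : R) N :
  (forall i, s i <= s i.+1) ->
  lebesgue_measure.-integrable `[s 0, s N] (EFin \o f) ->
  (forall i x, (i < N)%N -> s i <= x <= s i.+1 -> `|f x - f (s i)| <= e) ->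
  `|\int[lebesgue_measure]_(x in `[s 0, s N]) f x -
    \sum_(i < N) f (s i) * (s i.+1 - s i)| <= e * (s N - s 0).
Proof.
move=> s_le; have s0_le k : s 0 <= s k by elim: k => // k /le_trans->.
elim: N => [|N IH] fi fe.
  by rewrite set_itv1 Rintegral_set1 big_ord0 !subrr normr0 mulr0.
have fiN : lebesgue_measure.-integrable `[s 0, s N] (EFin \o f).
  apply: integrableS fi => //; apply: subset_itvl; rewrite bnd_simp; exact: s_le.
have fiN1 : lebesgue_measure.-integrable `]s N, s N.+1] (EFin \o f).
  apply: integrableS fi => //; apply: subset_itvr; rewrite bnd_simp; exact: s0_le.
have step : `|\int[lebesgue_measure]_(x in `]s N, s N.+1]) f x -
    f (s N) * (s N.+1 - s N)| <= e * (s N.+1 - s N).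
  have mu_itv : fine (lebesgue_measure `]s N, s N.+1]%classic) = s N.+1 - s N.
    rewrite lebesgue_measure_itv/= lte_fin.
    by case: ltgtP (s_le N) => // ->; rewrite subrr.
  have ic (r : R) : lebesgue_measure.-integrable `]s N, s N.+1] (EFin \o cst r).
    apply/integrableP; split; first exact/measurable_EFinP/measurable_cst.
    rewrite (eq_integral (cst `|r|%:E))// integral_cst//= lebesgue_measure_itv/=.
    by case: ifP => _; rewrite -?EFinD -?EFinM ?mule0 ltry.
  have cE (r : R) : r * (s N.+1 - s N) =
      \int[lebesgue_measure]_(x in `]s N, s N.+1]) cst r x.
    by rewrite Rintegral_cst// mu_itv.
  rewrite !cE -RintegralB//.
  have ib : lebesgue_measure.-integrable `]s N, s N.+1]
      (EFin \o (fun x => f x - cst (f (s N)) x)).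
    rewrite (_ : _ \o _ = ((EFin \o f) \- (EFin \o cst (f (s N))))%E)//.
    by apply: integrableB => //; exact: ic.
  apply: (le_trans (le_normr_Rintegral _ _)) => //.
  apply: le_Rintegral => //.
  - by have := integrable_abse ib.
  - move=> x; rewrite /= in_itv/= => /andP[sx xs]; apply: fe => //.
    by rewrite (ltW sx).
rewrite -(@subrK _ (\int[lebesgue_measure]_(x in `[s 0, s N]) f x) 
   (\int[lebesgue_measure]_(x in `[s 0, s N.+1]) f x)).
rewrite Rintegral_itvB//; last 2 first.
  - by rewrite bnd_simp.
  - by rewrite bnd_simp.
rewrite big_ord_recr/=.
have -> : forall a b u v : R, a + b - (u + v) = (b - u) + (a - v) by move=> *; ring.
rewrite (le_trans (ler_normD _ _))//.
have -> : e * (s N.+1 - s 0) = e * (s N - s 0) + e * (s N.+1 - s N) by ring.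
rewrite lerD//; apply: IH => // i x iN; apply: fe; exact: ltnW.
Qed.

Section geometric_riemann.
Context {R : realType}.
Variable l : R.
Hypothesis l_gt0 : 0 < l.

(** [N.+1] steps of this ratio lead from 1 to [expR l]; the successor avoids division by 0. *)
Definition mesh_ratio N : R := expR (l / N.+1%:R).

Lemma mesh_ratio_gt1 N : 1 < mesh_ratio N.
Proof. by rewrite expR_gt1 divr_gt0. Qed.

Lemma mesh_ratioX N : mesh_ratio N ^+ N.+1 = expR l.
Proof. by rewrite /mesh_ratio -expRM_natr divfK. Qed.

Lemma cvg_mesh_ratio : mesh_ratio N @[N --> \oo] --> (1 : R).
Proof.
rewrite [X in _ --> X](_ : 1 = expR (l * 0)); last by rewrite mulr0 expR0.
apply: (cvg_comp (fun N => l / N.+1%:R) expR); last exact: continuous_expR.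
by apply: cvgMr; exact: cvg_harmonic.
Qed.

(** The cells are unequal, but all have width at most [expR l * (q - 1)], which tends to 0. *)
Lemma cvg_geometric_riemann (f : R -> R) :
  {within `[1, expR l], continuous f} ->
  \sum_(i < N.+1) f (mesh_ratio N ^+ i) * (mesh_ratio N ^+ i.+1 - mesh_ratio N ^+ i)
    @[N --> \oo] --> \int[lebesgue_measure]_(x in `[1, expR l]) f x.
Proof.
move=> cf; apply/cvgrPdist_le => e e0.
have el : 0 < expR l by exact: expR_gt0.
have e'0 : 0 < e / expR l by rewrite divr_gt0.
have cK := @segment_compact _ (1 : R) (expR l).
have near_r := continuous_compact_uniform _ _ _ cK cf e'0.
have [r [/= Hr r0]] := filter_ex (filterI near_r (@nbhs_right_gt R 0)).
have fi := continuous_compact_integrable cK cf.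
have mesh : \forall N \near \oo, `|1 - mesh_ratio N| <= r / expR l.
  by move/cvgrPdist_le : cvg_mesh_ratio; apply; rewrite divr_gt0.
move: mesh; apply: filterS => N meshN.
set q := mesh_ratio N.
have q1 : 1 < q by exact: mesh_ratio_gt1.
have q0 : 0 < q by exact: lt_trans q1.
have qr : expR l * (q - 1) <= r.
  rewrite mulrC -ler_pdivlMr//; apply: le_trans (_ : `|1 - q| <= _); last exact: meshN.
  by rewrite distrC ler_norm.
pose s i := q ^+ i.
have s_le i : s i <= s i.+1 by rewrite ler_eXn2l.
have sN : s N.+1 = expR l by exact: mesh_ratioX.
have s0 : s 0 = 1 by rewrite /s expr0.
have := @riemann_sum_dist _ f s (e / expR l) N.+1 s_le.
rewrite sN s0 => /(_ fi) H.
apply: le_trans (H _) _.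
  move=> i x iN /andP[sx xs].
  have si1 : 1 <= s i by rewrite exprn_ege1// ltW.
  have siN : s i.+1 <= expR l by rewrite -sN ler_eXn2l.
  apply: Hr; rewrite /= ?in_itv/=.
  - by rewrite (le_trans si1 sx) (le_trans xs siN).
  - by rewrite si1 (le_trans (s_le i) siN).
  - rewrite ger0_norm ?subr_ge0//; apply: le_trans qr.
    apply: (@le_trans _ _ (s i.+1 - s i)); first by rewrite lerD2r.
    have -> : s i.+1 - s i = s i * (q - 1) by rewrite /s exprS; ring.
    by rewrite ler_wpM2r ?(le_trans (s_le i) siN)// subr_ge0 ltW.
rewrite mulrAC ler_pdivrMr// ler_pM2l//.
by rewrite gerBl.
Qed.
End geometric_riemann.

Section path_convergence.
Context {d : measure_display} {T : measurableType d} {R : realType}.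
Variables (B : R -> T -> R) (c : R) (n : nat) (w : T).
Hypothesis cB : {within `[0, +oo[, continuous (fun t => B t w)}.
Hypotheses (n_ge2 : (2 <= n)%N) (c_gt : - (1 / 2) < c).
Let q := mesh_ratio (ln (n%:R : R)).

(** With [f s = B s ^ 2 / s ^ 2], the summand [B (q ^ i) ^ 2 / q ^ i] is
    [f (q ^ i) * (q ^ i.+1 - q ^ i) / (q - 1)], and [(1 - 1 / q) / (q - 1) = 1 / q]. So the left
    side is a Riemann sum times a factor tending to [c * (1 + c) / 2]. *)
Lemma cvg_geometric_sum :
  riccati_weight c (1 - (q N)^-1) / 2 * geometric_sum B (q N) N.+1 w
    @[N --> \oo] --> c * (1 + c) / 2 * Lhat B n w.
Proof.
have n0 : 0 < (n%:R : R) by rewrite ltr0n (leq_trans _ n_ge2).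
have l0 : 0 < ln (n%:R : R) by rewrite ln_gt0// ltr1n.
have en : expR (ln (n%:R : R)) = n%:R by rewrite lnK// posrE.
pose f s := B s w ^+ 2 / s ^+ 2.
have cf : {within `[1, n%:R], continuous f}.
  apply/subspace_continuousP => x /=; rewrite in_itv/= => /andP[x1 xn].
  have x0 : 0 < x by exact: lt_le_trans x1.
  have cBx : B s w @[s --> within `[1, n%:R] (nbhs x)] --> B x w.
    have /subspace_continuousP : {within `[1, n%:R], continuous (fun t => B t w)}.
      apply: continuous_subspaceW cB => y /=; rewrite !in_itv/= => /andP[y1 _].
      by rewrite (le_trans _ y1).
    by apply; rewrite /= in_itv/= x1.
  have cs : s @[s --> within `[1, n%:R] (nbhs x)] --> x by exact: cvg_within.
  rewrite /f; apply: cvgM.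
    by rewrite expr2; under eq_fun do rewrite expr2; exact: cvgM.
  apply: cvgV; first by rewrite expf_neq0// gt_eqF.
  by rewrite expr2; under eq_fun do rewrite expr2; exact: cvgM.
have := cvg_geometric_riemann _ l0 f; rewrite en => /(_ cf) cvgf.
have q_cvg := @cvg_mesh_ratio R (ln n%:R).
have qi_cvg : (q N)^-1 @[N --> \oo] --> (1 : R).
  by rewrite -[X in _ --> X]invr1; apply: cvgV => //; rewrite oner_eq0.
have h_cvg : 1 - (q N)^-1 @[N --> \oo] --> (0 : R).
  by rewrite -(subrr 1); apply: cvgB => //; exact: cvg_cst.
have d_cvg : (1 + c * (1 - (q N)^-1))^-1 @[N --> \oo] --> (1 : R).
  rewrite -[X in _ --> X]invr1; apply: cvgV; first by rewrite oner_eq0.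
  rewrite -[X in _ --> X]addr0; apply: cvgD; first exact: cvg_cst.
  by rewrite -(mulr0 c); apply: cvgMr.
suff E N : riccati_weight c (1 - (q N)^-1) / 2 * geometric_sum B (q N) N.+1 w =
    c * (1 + c) / 2 * (q N)^-1 * (1 + c * (1 - (q N)^-1))^-1 *
    \sum_(i < N.+1) f (q N ^+ i) * (q N ^+ i.+1 - q N ^+ i).
  under eq_fun do rewrite E.
  have := cvgM (cvgM (cvgM (cvg_cst (c * (1 + c) / 2)) qi_cvg) d_cvg) cvgf.
  by rewrite !mulr1; exact.
have q1 : 1 < q N by exact: mesh_ratio_gt1.
have q0 : 0 < q N by exact: lt_trans q1.
have d0 : 0 < 1 + c * (1 - (q N)^-1).
  apply: riccati_eigen_gt0 => //; first by rewrite subr_gt0 invf_lt1.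
  by rewrite ltrBlDr ltrDl invr_gt0.
rewrite /riccati_weight /geometric_sum !mulr_sumr; apply: eq_bigr => i _.
rewrite /f [q N ^+ i.+1]exprS; have qi : q N ^+ i != 0 by rewrite expf_neq0// lt0r_neq0.
move: (B _ w) => b.
move: (q N ^+ i) qi => u u0.
move: d0; move: (q N) q0 => p p0 d0; field.
have -> : p + c * (p - 1) = p * (1 + c * (1 - p^-1)).
  by field; exact: lt0r_neq0.
by rewrite u0 mulf_neq0 lt0r_neq0.
Qed.
End path_convergence.

(** * Passage to the limit *)

Section pointwise_limits.
Context {d : measure_display} {T : measurableType d} {R : realType}.
Variables (P : probability T R) (Y_ : nat -> T -> R) (Y : T -> R).
Hypotheses (mY_ : forall N, measurable_fun setT (Y_ N))
  (Y_ge0 : forall N w, 0 <= Y_ N w)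
  (Y_cvg : forall w, Y_ N w @[N --> \oo] --> Y w).

Lemma limit_measurable : measurable_fun setT Y.
Proof. by apply: measurable_fun_cvg mY_ _ => w _; exact: Y_cvg. Qed.

Lemma limit_ge0 w : 0 <= Y w.
Proof. by apply: cvgr_to_ge (Y_cvg w) _; exact: nearW. Qed.

Lemma limit_integral_le (M : R) :
  (\forall N \near \oo, (\int[P]_w (Y_ N w)%:E <= M%:E)%E) ->
  (\int[P]_w (Y w)%:E <= M%:E)%E.
Proof.
move=> YM.
have := @fatou _ _ _ P setT measurableT (fun N w => (Y_ N w)%:E).
have m_ N : measurable_fun setT (fun w => (Y_ N w)%:E) by exact/measurable_EFinP.
have p_ N w : setT w -> (0 <= (Y_ N w)%:E)%E by rewrite lee_fin.
move=> /(_ m_ p_) F.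
have -> : (\int[P]_w (Y w)%:E = \int[P]_w limn_einf (fun N => (Y_ N w)%:E))%E.
  apply: eq_integral => w _; apply/esym.
  have cE : (Y_ N w)%:E @[N --> \oo] --> (Y w)%:E by apply: cvg_EFin; [exact: nearW|exact: Y_cvg].
  by rewrite is_cvg_limn_einfE; [exact/cvg_lim|apply/cvg_ex; exists (Y w)%:E].
apply: le_trans F _; rewrite limn_einf_lim; apply: lime_le.
  exact: is_cvg_einfs.
apply: filterS YM => N; apply: le_trans; apply: ereal_inf_lbound.
by exists N => /=.
Qed.

(** Truncation at [k] supplies a constant dominating function, and the truncated limit is at most
    [Y]. *)
Lemma limit_integral_ge (k m : R) : 0 <= k ->
  (\forall N \near \oo, (m%:E <= \int[P]_w (Num.min (Y_ N w) k)%:E)%E) ->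
  (m%:E <= \int[P]_w (Y w)%:E)%E.
Proof.
move=> k0 Ym; have mY := limit_measurable.
have mmin (f : T -> R) : measurable_fun setT f ->
    measurable_fun setT (fun w => (Num.min (f w) k)%:E).
  by move=> mf; apply/measurable_EFinP; apply: measurable_minr.
have min_ge0 (f : T -> R) w : 0 <= f w -> 0 <= Num.min (f w) k.
  by move=> f0; rewrite le_min f0.
have ik : P.-integrable setT (cst k%:E) by exact: finite_measure_integrable_cst.
have [||_ _ H] := @dominated_convergence _ _ _ P setT measurableT
  (fun N w => (Num.min (Y_ N w) k)%:E) (fun w => (Num.min (Y w) k)%:E) (cst k%:E)
  (fun N => mmin _ (mY_ N)) (mmin _ mY) _ ik _.
- apply: aeW => w _; apply: cvg_EFin; first exact: nearW.
  rewrite /comp /=; under eq_fun do rewrite minr_absE.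
  rewrite minr_absE; apply: cvgMl; apply: cvgB.
    by apply: cvgD; [exact: Y_cvg|exact: cvg_cst].
  by apply: cvg_norm; apply: cvgB; [exact: Y_cvg|exact: cvg_cst].
- apply: aeW => w N _; rewrite /= lee_fin ger0_norm ?min_ge0//.
  by rewrite ge_min lexx orbT.
apply: (@le_trans _ _ (\int[P]_w (Num.min (Y w) k)%:E)%E).
  exact: cvge_to_ge H Ym.
apply: ge0_le_integral => //.
- by move=> w _; rewrite lee_fin min_ge0// limit_ge0.
- exact: mmin.
- exact/measurable_EFinP.
- by move=> w _; rewrite lee_fin ge_min lexx.
Qed.
End pointwise_limits.

(** * Growth of the eigenvalue power as the mesh is refined *)

Section eigenvalue_power.
Context {R : realType}.
Variables (c l : R).
Hypotheses (c_gt : - (1 / 2) < c) (l_gt0 : 0 < l).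
Let h N := 1 - (mesh_ratio l N)^-1.

Lemma mesh_step_gt0 N : 0 < h N.
Proof.
rewrite subr_gt0 invf_lt1; first exact: mesh_ratio_gt1.
exact: lt_trans (mesh_ratio_gt1 _ l_gt0 N).
Qed.

Lemma mesh_step_lt1 N : h N < 1.
Proof. by rewrite ltrBlDr ltrDl invr_gt0 (lt_trans _ (mesh_ratio_gt1 _ l_gt0 N)). Qed.

Lemma cvg_mesh_step : h N @[N --> \oo] --> (0 : R).
Proof.
rewrite -(subrr 1); apply: cvgB; first exact: cvg_cst.
rewrite -[X in _ --> X]invr1; apply: cvgV; first by rewrite oner_eq0.
exact: cvg_mesh_ratio.
Qed.

(** Squeeze from [1 - 1 / q <= ln q <= q - 1], where [ln q = l / N.+1]. *)
Lemma cvg_mesh_step_total : N.+1%:R * h N @[N --> \oo] --> l.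
Proof.
apply: (@squeeze_cvgr _ _ _ _ (fun N => l * (mesh_ratio l N)^-1) (fun=> l)).
- apply: nearW => N; have N0 : 0 < (N.+1%:R : R) by [].
  set q := mesh_ratio l N; have q0 : 0 < q by exact: expR_gt0.
  have lE : l = N.+1%:R * (l / N.+1%:R) by rewrite mulrC divfK.
  apply/andP; split.
    rewrite {1}lE -mulrA ler_pM2l// /h -/q.
    have -> : 1 - q^-1 = (q - 1) / q by field; exact: lt0r_neq0.
    by rewrite ler_pM2r ?invr_gt0// lerBrDl expR_ge1Dx.
  rewrite [X in _ <= X]lE ler_pM2l// /h lerBlDr -lerBlDl.
  by rewrite /mesh_ratio -expRN expR_ge1Dx.
- rewrite -[X in _ --> X]mulr1; apply: cvgMr.
  rewrite -[X in _ --> X]invr1; apply: cvgV; first by rewrite oner_eq0.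
  exact: cvg_mesh_ratio.
- exact: cvg_cst.
Qed.

(** From [x / (1 + x) <= ln (1 + x) <= x] with [x = c * h N]. How large [N] must be depends on [l],
    but the slack 1 does not; this gives uniformity in [n]. *)
Lemma eigenvalue_power_bounds : \forall N \near \oo,
  expR (c * l - 1) <= (1 + c * h N) ^+ N.+1 <= expR (c * l + 1).
Proof.
have ct : c * (N.+1%:R * h N) @[N --> \oo] --> c * l.
  by apply: cvgMr; exact: cvg_mesh_step_total.
have up : \forall N \near \oo, c * (N.+1%:R * h N) <= c * l + 1.
  by move/cvgr_le : ct; apply; rewrite ltrDl.
have lo : \forall N \near \oo,
    c * l - 1 <= c * (N.+1%:R * h N) * (1 + c * h N)^-1.
  have cd : (1 + c * h N)^-1 @[N --> \oo] --> (1 : R).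
    rewrite -[X in _ --> X]invr1; apply: cvgV; first by rewrite oner_eq0.
    rewrite -[X in _ --> X]addr0; apply: cvgD; first exact: cvg_cst.
    by rewrite -(mulr0 c); apply: cvgMr; exact: cvg_mesh_step.
  have H : c * (N.+1%:R * h N) * (1 + c * h N)^-1 @[N --> \oo] --> c * l.
    by rewrite -[X in _ --> X]mulr1; exact: cvgM.
  by move/cvgr_ge : H; apply; rewrite ltrBlDr ltrDl.
apply: filterS2 lo up => N lo up.
have y0 := riccati_eigen_gt0 _ _ c_gt (mesh_step_gt0 N) (mesh_step_lt1 N).
apply/andP; split.
  apply: (@le_trans _ _ (expR (c * h N / (1 + c * h N) * N.+1%:R))).
    by rewrite ler_expR (le_trans lo)// [N.+1%:R * _]mulrC [c * (_ * _)]mulrA mulrAC.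
  rewrite expRM_natr; apply: lerXn2r; rewrite ?nnegrE ?expR_ge0 ?(ltW y0)//.
  rewrite -[X in _ <= X]invrK -[X in X <= _]invrK -expRN.
  rewrite lef_pV2 ?posrE ?expR_gt0 ?invr_gt0//.
  (* [1 / (1 + x) = 1 - x / (1 + x) <= exp (- x / (1 + x))]. *)
  apply: le_trans (expR_ge1Dx _).
  by rewrite le_eqVlt; apply/orP; left; apply/eqP; field; exact: lt0r_neq0.
apply: (@le_trans _ _ (expR (c * h N * N.+1%:R))); last first.
  by rewrite ler_expR (le_trans _ up)// mulrAC mulrA.
rewrite expRM_natr; apply: lerXn2r; rewrite ?nnegrE ?expR_ge0 ?(ltW y0)//.
exact: expR_ge1Dx.
Qed.
End eigenvalue_power.

Lemma sqrt_expR {R : realType} (x : R) : Num.sqrt (expR x) = expR (x / 2).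
Proof.
by rewrite {1}(splitr x) expRD -expr2 sqrtr_sqr ger0_norm// expR_ge0.
Qed.

(** * Two-sided bounds on the Laplace transform of [Lhat] *)

Section laplace_bounds.
Context {d : measure_display} {T : measurableType d} {R : realType}.
Variables (P : probability T R) (B : R -> T -> R).
Hypothesis BM : standard_brownian_motion P B.
Variable n : nat.
Hypothesis n_ge2 : (2 <= n)%N.
Let l : R := ln n%:R.
Let q := mesh_ratio l.
Let h N := 1 - (q N)^-1.

Let l_gt0 : 0 < l. Proof. by rewrite ln_gt0// ltr1n. Qed.
Let h_gt0 N : 0 < h N. Proof. exact: mesh_step_gt0. Qed.
Let h_lt1 N : h N < 1. Proof. exact: mesh_step_lt1. Qed.

Let G N w := geometric_sum B (q N) N.+1 w.
Let Y c N w := expR (- (riccati_weight c (h N) / 2 * G N w)).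

Let G_ge0 N w : 0 <= G N w.
Proof.
apply: sumr_ge0 => i _; rewrite divr_ge0 ?sqr_ge0// exprn_ge0// ltW//.
exact: lt_trans (mesh_ratio_gt1 _ l_gt0 N).
Qed.

Let mY c N : measurable_fun setT (Y c N).
Proof.
apply: measurableT_comp => //; apply: measurableT_comp => //.
apply: measurable_funM => //; apply: measurable_sum => i.
apply: measurable_funM => //; apply: measurable_funX.
case: BM => mB _ _ _ _; apply: mB; rewrite exprn_ge0// ltW//.
exact: lt_trans (mesh_ratio_gt1 _ l_gt0 N).
Qed.

Let Y_ge0 c N w : 0 <= Y c N w. Proof. exact: expR_ge0. Qed.

Let Y_cvg c : - (1 / 2) < c -> forall w,
  Y c N w @[N --> \oo] --> expR (- (c * (1 + c) / 2 * Lhat B n w)).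
Proof.
move=> c_gt w.
apply: (cvg_comp (fun N => - (riccati_weight c (h N) / 2 * G N w)) expR);
  last exact: continuous_expR.
apply: cvgN; apply: cvg_geometric_sum => //.
by case: BM.
Qed.

(** These arise by putting [eigenvalue_power_bounds] into [laplace_geometric_sum]. *)
Definition laplace_lb c := (Num.sqrt (riccati_const c))^-1 * expR (- (c * l + 1) / 2).
Definition laplace_ub c := expR (- (c * l - 1) / 2).

Lemma laplace_lb_gt0 c : - (1 / 2) < c -> 0 < laplace_lb c.
Proof.
by move=> c_gt; rewrite mulr_gt0 ?expR_gt0// invr_gt0 sqrtr_gt0 riccati_const_gt0.
Qed.

Let Y_bounds c : - (1 / 2) < c -> \forall N \near \oo,
  ((laplace_lb c)%:E <= \int[P]_w (Y c N w)%:E <= (laplace_ub c)%:E)%E.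
Proof.
move=> c_gt; apply: filterS (eigenvalue_power_bounds _ _ c_gt l_gt0) => N.
move=> /andP[lo up].
have /andP[Ylo Yup] := laplace_geometric_sum _ _ BM _ _ c_gt
  (mesh_ratio_gt1 _ l_gt0 N) N.+1.
have K0 := riccati_const_gt0 _ c_gt.
have p0 : 0 < (1 + c * (1 - (mesh_ratio l N)^-1)) ^+ N.+1.
  by apply: lt_le_trans lo; exact: expR_gt0.
apply/andP; split.
  apply: le_trans Ylo; rewrite lee_fin sqrtrM ?(ltW K0)// invfM /laplace_lb.
  rewrite ler_pM2l ?invr_gt0 ?sqrtr_gt0//.
  rewrite mulNr expRN lef_pV2 ?posrE ?sqrtr_gt0 ?expR_gt0//.
  by rewrite -sqrt_expR ler_wsqrtr.
apply: le_trans Yup _; rewrite lee_fin /laplace_ub.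
rewrite mulNr expRN lef_pV2 ?posrE ?sqrtr_gt0 ?expR_gt0//.
by rewrite -sqrt_expR ler_wsqrtr.
Qed.

Lemma laplace_le c : - (1 / 2) < c ->
  (\int[P]_w (expR (- (c * (1 + c) / 2 * Lhat B n w)))%:E <= (laplace_ub c)%:E)%E.
Proof.
move=> c_gt; apply: (limit_integral_le _ (Y c)) => //; first exact: Y_cvg.
by apply: filterS (Y_bounds c c_gt) => N /andP[].
Qed.

(** The exponent is nonpositive, so truncation at 1 changes nothing. *)
Lemma laplace_ge_pos c : 0 <= c ->
  ((laplace_lb c)%:E <= \int[P]_w (expR (- (c * (1 + c) / 2 * Lhat B n w)))%:E)%E.
Proof.
move=> c0; have c_gt : - (1 / 2) < c by lra.
apply: (limit_integral_ge _ (Y c) _ _ _ _ 1) => //; first exact: Y_cvg.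
apply: filterS (Y_bounds c c_gt) => N /andP[+ _].
suff -> : (\int[P]_w (Num.min (Y c N w) 1)%:E = \int[P]_w (Y c N w)%:E)%E by [].
apply: eq_integral => w _; congr EFin; apply/min_idPl.
rewrite -expR0 ler_expR oppr_le0 mulr_ge0// divr_ge0//.
have e0 := riccati_eigen_gt0 _ _ c_gt (h_gt0 N) (h_lt1 N).
by rewrite divr_ge0 ?(ltW e0)// !mulr_ge0 ?(ltW (h_gt0 N)) ?addr_ge0.
Qed.

(* Uniform integrability: the parameter [c' < c] still has bounded
   exponential moments, which controls the part of [Y c] above a high level. *)
Lemma laplace_ge_neg c : - (1 / 2) < c -> c < 0 ->
  ((laplace_lb c / 2)%:E <=
   \int[P]_w (expR (- (c * (1 + c) / 2 * Lhat B n w)))%:E)%E.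
Proof.
move=> c_gt c0.
(* The midpoint of [- 1 / 2] and [c]. *)
pose c' := (c - 1 / 2) / 2.
have c'_gt : - (1 / 2) < c' by rewrite /c'; lra.
have c'c : c' < c by rewrite /c'; lra.
have cc0 : c * (1 + c) < 0 by nra.
pose p := c' * (1 + c') / (c * (1 + c)).
(* [c * (1 + c)] is increasing beyond [- 1 / 2], so both products are negative and that of [c'] is
   the larger in modulus. *)
have p1 : 1 < p by rewrite /p ltr_ndivlMr// mul1r; nra.
(* This amounts to [Y c ^ p <= Y c'] on every grid. *)
have weight N : - (p * riccati_weight c (h N)) <= - riccati_weight c' (h N).
  rewrite lerN2 /riccati_weight.
  have e0 := riccati_eigen_gt0 _ _ c_gt (h_gt0 N) (h_lt1 N).
  have e'0 := riccati_eigen_gt0 _ _ c'_gt (h_gt0 N) (h_lt1 N).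
  have -> : p * (c * (1 + c) * h N / (1 + c * h N)) =
      c' * (1 + c') * h N / (1 + c * h N).
    have c1 : 0 < 1 + c by lra.
    by rewrite /p; field; rewrite (lt0r_neq0 e0) (lt0r_neq0 c1) (ltr0_neq0 c0).
  rewrite ler_wnM2l//; first by rewrite mulr_le0_ge0 ?(ltW (h_gt0 N))//; nra.
  by rewrite lef_pV2 ?posrE// lerD2l ler_wpM2r ?(ltW (h_gt0 N)) ?ltW.
have m0 := laplace_lb_gt0 c c_gt.
set m := laplace_lb c in m0 *.
set M := laplace_ub c'.
have M0 : 0 < M by exact: expR_gt0.
(* Chosen to make the truncation error [m / 2]; it may depend on [n], as the final bound does not
   involve it. *)
pose k := ln (M / (m / 2)) / (p - 1).
have p10 : 0 < p - 1 by rewrite subr_gt0.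
have kE : expR (- ((p - 1) * k)) * M = m / 2.
  rewrite /k mulrC mulrCA mulfV ?lt0r_neq0// mulr1 expRN lnK ?posrE ?divr_gt0//.
  by rewrite invf_div mulrC divfK// lt0r_neq0.
(* Where [Y c > exp k], [Y c = Y c ^ p * Y c ^ (1 - p) <= Y c' * exp (- (p - 1) k)]. *)
have trunc N w : Y c N w <=
    Num.min (Y c N w) (expR k) + expR (- ((p - 1) * k)) * Y c' N w.
  have [le|lt] := leP (Y c N w) (expR k).
    by rewrite lerDl mulr_ge0// expR_ge0.
  rewrite ler_wpDl ?expR_ge0// -expRD ler_expR.
  move: lt; rewrite ltr_expR.
  have /= := ler_wpM2r (G_ge0 N w) (weight N).
  move: (riccati_weight c (h N)) (riccati_weight c' (h N)) (G N w) => a b g H lt.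
  have : 0 <= (p - 1) * (- (a / 2 * g) - k) by rewrite mulr_ge0 ?(ltW p10)// subr_ge0 ltW.
  by move: H; lra.
apply: (limit_integral_ge _ (Y c) _ _ _ _ (expR k)) => //; first exact: Y_cvg.
apply: filterS2 (Y_bounds c c_gt) (Y_bounds c' c'_gt) => N /andP[lo _] /andP[_ up].
have mmin : measurable_fun setT (fun w => (Num.min (Y c N w) (expR k))%:E).
  by apply/measurable_EFinP; apply: measurable_minr.
have mine0 w : (0 <= (Num.min (Y c N w) (expR k))%:E)%E.
  by rewrite lee_fin le_min !expR_ge0.
have : (m%:E <= \int[P]_w (Num.min (Y c N w) (expR k))%:E + (m / 2)%:E)%E.
  apply: le_trans lo _.
  apply: (@le_trans _ _ (\int[P]_w ((Num.min (Y c N w) (expR k))%:E +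
      (expR (- ((p - 1) * k)))%:E * (Y c' N w)%:E))%E).
    apply: ge0_le_integral => //.
    - by move=> w _; rewrite lee_fin.
    - exact/measurable_EFinP.
    - by apply: emeasurable_funD => //; apply/measurable_EFinP; apply: measurable_funM.
    - by move=> w _; rewrite -EFinM -EFinD lee_fin.
  rewrite ge0_integralD//=; last 2 first.
  - by move=> w _; rewrite -EFinM lee_fin mulr_ge0 ?expR_ge0.
  - by apply/measurable_EFinP; apply: measurable_funM.
  rewrite leeD2l// ge0_integralZl//=; last 2 first.
  - exact/measurable_EFinP.
  - by move=> w _; rewrite lee_fin.
  by rewrite -kE EFinM lee_wpmul2l// lee_fin expR_ge0.
by rewrite -leeBlDr// -EFinB {1}(splitr m) addrK.
Qed.

End laplace_bounds.

Theorem mainTheorem16 (R : realType) (d : measure_display) (T : measurableType d)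
  (P : probability T R) (B : R -> T -> R) (t : R) :
  standard_brownian_motion P B -> - (1 / 8) < t ->
  exists C : R, forall n : nat, (2 <= n)%N ->
    laplace_Lhat P B t n \is a fin_num /\
    `| ln (fine (laplace_Lhat P B t n))
       - (1 - Num.sqrt (1 + 8 * t)) / 4 * ln (n%:R : R) | <= C.
Proof.
move=> BM t_gt.
set s := Num.sqrt (1 + 8 * t).
have s0 : 0 < s by rewrite sqrtr_gt0; lra.
have s2 : s ^+ 2 = 1 + 8 * t by rewrite sqr_sqrtr//; lra.
pose c := (s - 1) / 2.
have c_gt : - (1 / 2) < c by rewrite /c; lra.
have tE : c * (1 + c) / 2 = t.
  have -> : t = (s ^+ 2 - 1) / 8 by rewrite s2; field.
  by rewrite /c; field.
(* The factor 1/2 is the loss in [laplace_ge_neg], accepted for both signs of [c]. *)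
pose K := (Num.sqrt (riccati_const c))^-1 / 2.
have K0 : 0 < K by rewrite divr_gt0// invr_gt0 sqrtr_gt0 riccati_const_gt0.
(* The 1/2 is the slack 1 of [eigenvalue_power_bounds], halved by the square root. *)
exists (1 / 2 + `|ln K|) => n n_ge2.
set L := laplace_Lhat P B t n.
have LE : L = (\int[P]_w (expR (- (c * (1 + c) / 2 * Lhat B n w)))%:E)%E.
  by apply: eq_integral => w _; rewrite tE mulNr.
have up : (L <= (laplace_ub n c)%:E)%E by rewrite LE laplace_le.
have lo : ((laplace_lb n c / 2)%:E <= L)%E.
  rewrite LE; have [c0|c0] := leP 0 c; last exact: laplace_ge_neg.
  apply: le_trans (laplace_ge_pos _ _ BM _ n_ge2 _ c0).
  by rewrite lee_fin ler_pdivrMr// ler_peMr ?ler1n// ltW// laplace_lb_gt0.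
have lb0 : 0 < laplace_lb n c / 2 by rewrite divr_gt0// laplace_lb_gt0.
have Lfin : L \is a fin_num.
  rewrite ge0_fin_numE ?(le_lt_trans up) ?ltry//.
  by apply: le_trans lo; rewrite lee_fin ltW.
split => //.
have {}up : fine L <= laplace_ub n c by rewrite -lee_fin fineK.
have {}lo : laplace_lb n c / 2 <= fine L by rewrite -lee_fin fineK.
have F0 : 0 < fine L by exact: lt_le_trans lo.
set l : R := ln n%:R.
have lnup : ln (fine L) <= - (c * l - 1) / 2.
  by rewrite -[leRHS]expRK ler_ln ?posrE ?expR_gt0.
have lnlo : ln K + - (c * l + 1) / 2 <= ln (fine L).
  rewrite -[X in _ + X]expRK -lnM ?posrE ?expR_gt0// ler_ln ?posrE ?(mulr_gt0 K0 (expR_gt0 _))//.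
  by apply: le_trans lo; rewrite /laplace_lb /K mulrAC.
have -> : (1 - s) / 4 = - c / 2 by rewrite /c; field.
have nK := ler_norm (- ln K); rewrite normrN in nK.
have nK0 := normr_ge0 (ln K).
by rewrite ler_norml; apply/andP; split; lra.
Qed.
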